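(* For every $n\ge 1$, the number $L_{n^3}$ of Latin cubes of order $n$ satisfies $$L_{n^3}=\sum_{A\in B_n}(-1)^{\sigma_0(A)}\,\mathrm{Per}(A)^{n^2}.$$
   Context: A Latin cube of order $n$ is an $n\times n\times n$ array $L=(L_{ijk})$ with entries in $[n^2]=\{1,\dots,n^2\}$ such that each symbol of $[n^2]$ occurs exactly once in each $i$-slice (fixed $i$), each $j$-slice and each $k$-slice; $L_{n^3}$ is the number of all of them. $B_n$ is the set of all $n\times n\times n$ arrays with entries in $\{0,1\}$; for $A\in B_n$, $\sigma_0(A)$ is the number of zero entries of $A$. The hyperpermanent is $\mathrm{Per}(A)=\sum_{\sigma\in S_n}\sum_{\tau\in S_n}\prod_{i=1}^n A_{i,\sigma(i),\tau(i)}$. *)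

(* Defs.v *)
From HB Require Import structures.
From mathcomp Require Import all_boot all_order all_algebra all_fingroup.

Set Implicit Arguments.
Unset Strict Implicit.
Unset Printing Implicit Defensive.

Import GRing.Theory.
Local Open Scope ring_scope.

(* The symbols 1, ..., n^2 are encoded as 0, ..., n^2 - 1. *)
Definition latin_cube (n : nat) (L : {ffun 'I_n * 'I_n * 'I_n -> 'I_(n ^ 2)}) : bool :=
  [forall s : 'I_(n ^ 2),
    [&& [forall i : 'I_n, #|[set p : 'I_n * 'I_n | L (i, p.1, p.2) == s]| == 1%N],
        [forall j : 'I_n, #|[set p : 'I_n * 'I_n | L (p.1, j, p.2) == s]| == 1%N]
      & [forall k : 'I_n, #|[set p : 'I_n * 'I_n | L (p.1, p.2, k) == s]| == 1%N]]].

Definition num_latin_cubes (n : nat) : nat :=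
  #|[set L : {ffun 'I_n * 'I_n * 'I_n -> 'I_(n ^ 2)} | latin_cube L]|.

(* 0/1 arrays are boolean arrays, with false as 0 and true as 1. *)
Definition sigma0 (n : nat) (A : {ffun 'I_n * 'I_n * 'I_n -> bool}) : nat :=
  #|[set p | A p == false]|.

Definition Per (n : nat) (R : comNzRingType)
    (A : {ffun 'I_n * 'I_n * 'I_n -> R}) : R :=
  \sum_(s : 'S_n) \sum_(t : 'S_n) \prod_(i < n) A (i, s i, t i).

Definition int_array (n : nat) (A : {ffun 'I_n * 'I_n * 'I_n -> bool}) :
    {ffun 'I_n * 'I_n * 'I_n -> int} :=
  [ffun p => (A p)%:R].

(* Main.v *)
Require Import Defs.
From mathcomp Require Import all_boot all_order all_algebra all_fingroup.

(** The sign-weighted sum over 0/1 arrays is an inclusion-exclusion.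
    A term of [Per A] is a product of [n] entries of [A], at cells
    [(i, s i, t i)] that meet every slice in each direction exactly once; call
    such a set of cells a diagonal, given by the pair [(s, t)].  Expanding
    [Per A ^+ (n ^ 2)] gives a sum over families of [n ^ 2] diagonals indexed by
    the symbols, and the term of a family is 1 when the support of [A] contains
    all its cells, and 0 otherwise.  Summing over [A] with signs
    first ([signed_sum_covering]), a cell outside the family contributes a
    factor [1 - 1 = 0], so that only the families covering the whole cube
    survive, each with weight 1.

    A covering family uses [n ^ 2 * n] cells to cover [n ^ 3], hence its
    diagonals are pairwise disjoint.  Giving the symbol [c] to the cells of the
    [c]-th diagonal then fills the cube, and this is a Latin cube since a
    diagonal meets each slice once.  Conversely the cells of a Latin cube that
    carry a given symbol form a diagonal.  This correspondence is counted through
    the incidence relation [labels f L] between families and fillings: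
    [card_labelling_families] and [card_latin_labelled] say that it matches
    Latin cubes and covering families one to one. *)

Set Implicit Arguments.
Unset Strict Implicit.
Unset Printing Implicit Defensive.

Import GRing.Theory.
Local Open Scope ring_scope.

(** Both factors split as products over the points [p], so that the sum over
    [A] factors into [\prod_p \sum_b]; the factor at [p] is [-1 + 1] when [p]
    is not a value of [g], and [0 + 1] when it is, because [b = false] is then
    killed by the entries of [A] on the values of [g]. *)
Lemma signed_sum_covering (R : comNzRingType) (I J : finType) (g : J -> I) :
  \sum_(A : {ffun I -> bool})
     (-1) ^+ #|[set p | A p == false]| * \prod_j (A (g j))%:R
  = [forall p, p \in codom g]%:R :> R.
Proof.
have prod_bool (K : finType) (P : pred K) :
    \prod_k (P k)%:R = [forall k, P k]%:R :> R.
  case: forallP => [allP | nallP]; first by rewrite big1 // => k _; rewrite allP.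
  have /existsP[k /negbTE Pk] : [exists k, ~~ P k].
    by rewrite -negb_forall; apply/forallP.
  by rewrite (bigD1 k) //= Pk mul0r.
pose F p (b : bool) : R := (-1) ^+ (~~ b) * ((p \in codom g) ==> b)%:R.
transitivity (\sum_(A : {ffun I -> bool}) \prod_p F p (A p)).
  apply: eq_bigr => A _; rewrite big_split /= !prod_bool; congr (_ * _%:R).
    rewrite -sum1_card -prodrXr big_mkcond /=; apply: eq_bigr => p _.
    by rewrite inE; case: (A p).
  congr nat_of_bool; apply/forallP/forallP => [Ag p | Ag j].
    by apply/implyP => /codomP[j ->].
  by have := Ag (g j); rewrite codom_f.
rewrite -bigA_distr_bigA -prod_bool; apply: eq_bigr => p _.
rewrite big_bool /F /= expr0 expr1 implybT implybF mulN1r mulr1.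
by case: (p \in codom g); rewrite /= ?subr0 ?subrr.
Qed.

Section Families.

Variable n : nat.

Notation cells := ('I_n * 'I_n * 'I_n)%type.
Notation family := {ffun 'I_(n ^ 2) -> 'S_n * 'S_n}.
Notation filling := {ffun cells -> 'I_(n ^ 2)}.

Implicit Types (f : family) (L : filling).

Definition cell f (ci : 'I_(n ^ 2) * 'I_n) : cells :=
  (ci.2, (f ci.1).1 ci.2, (f ci.1).2 ci.2).

Definition covering f := [forall p, p \in codom (cell f)].

Definition labels f L := [forall ci, L (cell f ci) == ci.1].

Lemma labelsP f L : reflect (forall c i, L (cell f (c, i)) = c) (labels f L).
Proof.
apply: (iffP forallP) => [lab c i | lab [c i]]; first exact: (eqP (lab (c, i))).
by apply/eqP/lab.
Qed.

(** By distributivity, [Per A ^+ (n ^ 2)] is a sum over families [f] of the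
    product of the entries of [A] at the values of [cell f]; once the sums are
    exchanged, [signed_sum_covering] evaluates the one over [A]. *)
Lemma signed_sum_Per :
  \sum_(A : {ffun cells -> bool})
     (-1) ^+ sigma0 A * Per (int_array A) ^+ (n ^ 2)%N
  = (\sum_f covering f)%N%:Z.
Proof.
transitivity (\sum_(A : {ffun cells -> bool}) \sum_f
   (-1) ^+ sigma0 A * \prod_ci (A (cell f ci))%:R : int).
  apply: eq_bigr => A _; rewrite -big_distrr /=; congr (_ * _).
  rewrite /Per pair_bigA /= -[in LHS](card_ord (n ^ 2)) -prodr_const.
  rewrite (bigA_distr_bigA (fun (_ : 'I_(n ^ 2)) (st : 'S_n * 'S_n) =>
    \prod_(i < n) int_array A (i, st.1 i, st.2 i))) /=.
  apply: eq_bigr => f _; rewrite pair_bigA /=.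
  by apply: eq_bigr => ci _; rewrite ffunE.
rewrite exchange_big /= -[RHS]natz natr_sum.
by apply: eq_bigr => f _; rewrite -signed_sum_covering.
Qed.

(** There are as many indices [(c, i)] as cells, [n ^ 2 * n = n ^ 3], so a
    surjection between them is injective. *)
Lemma covering_inj f : covering f -> injective (cell f).
Proof.
move=> /forallP cov; apply/injectiveP/card_uniqP.
rewrite size_map -cardT card_prod !card_ord.
rewrite (eq_card (B := {: cells})) => [|p]; last by rewrite cov.
by rewrite !card_prod !card_ord expnS expn1.
Qed.

Lemma latin_cubeP L :
  reflect
    (forall c,
      [/\ forall i, exists! p : 'I_n * 'I_n, L (i, p.1, p.2) = c,
          forall j, exists! p : 'I_n * 'I_n, L (p.1, j, p.2) = c
        & forall k, exists! p : 'I_n * 'I_n, L (p.1, p.2, k) = c])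
    (latin_cube L).
Proof.
have uniqP (F : 'I_n * 'I_n -> 'I_(n ^ 2)) c :
    reflect (exists! p, F p = c) (#|[set p | F p == c]| == 1%N).
  apply: (iffP cards1P) => [[p /setP Fp] | [p [Fp p_uniq]]]; exists p.
    split=> [|q Fq]; first by have := Fp p; rewrite !inE eqxx => /eqP.
    by have := Fp q; rewrite !inE Fq eqxx => /esym/eqP.
  apply/setP=> q; rewrite !inE.
  by apply/eqP/eqP => [/p_uniq | ->].
apply: (iffP forallP) => lat c.
  have /and3P[/forallP lati /forallP latj /forallP latk] := lat c.
  by split=> x; apply/uniqP.
have [lati latj latk] := lat c.
by apply/and3P; split; apply/forallP => x; apply/uniqP.
Qed.

(** The cell [p] lies on the diagonal of its own symbol, because that diagonal
    meets the slice of [p] in the first direction, where the symbol occurs only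
    once. *)
Lemma labels_latin_covering f L : latin_cube L -> labels f L -> covering f.
Proof.
move=> /latin_cubeP lat /labelsP lab; apply/forallP => -[[i j] k].
have [/(_ i)[p [_ p_uniq]] _ _] := lat (L (i, j, k)).
apply/codomP; exists (L (i, j, k), i).
have /= := p_uniq (_, _) (lab (L (i, j, k)) i).
by rewrite (p_uniq (j, k) erefl) /cell => -[<- <-].
Qed.

(** Each slice meets the diagonal [f c], and every cell with symbol [c] lies on
    that diagonal, where its position is determined by any one coordinate. *)
Lemma labels_covering_latin f L : covering f -> labels f L -> latin_cube L.
Proof.
move=> /forallP cov /labelsP lab; apply/latin_cubeP => c.
have on_diag p : L p = c -> exists i, p = cell f (c, i).
  by have /codomP[[c' i] ->] := cov p; rewrite lab => ->; exists i.
split=> x.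
- exists ((f c).1 x, (f c).2 x); split=> [|[j k] /on_diag[i]]; first exact: lab.
  by rewrite /cell /= => -[-> -> ->].
- pose i := ((f c).1^-1)%g x.
  exists (i, (f c).2 i); split=> [|[i' k] /on_diag[i2]] /=.
    by rewrite -[RHS](lab c i) /cell /= permKV.
  by rewrite /cell /i /= => -[-> -> ->]; rewrite permK.
- pose i := ((f c).2^-1)%g x.
  exists (i, (f c).1 i); split=> [|[i' j] /on_diag[i2]] /=.
    by rewrite -[RHS](lab c i) /cell /= permKV.
  by rewrite /cell /i /= => -[-> -> ->]; rewrite permK.
Qed.

(** The slices in the first direction make the cells with symbol [c] a graph
    [(i, s i, t i)]; [s] and [t] are injective because [c] occurs only once in
    each slice in the second and third directions. *)
Lemma latin_labelled L : latin_cube L -> exists f, labels f L.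
Proof.
move=> /latin_cubeP lat.
have perms c : exists st : 'S_n * 'S_n, forall i, L (i, st.1 i, st.2 i) = c.
  have [lati latj latk] := lat c.
  have /fin_all_exists[h Lh] i : exists p : 'I_n * 'I_n, L (i, p.1, p.2) = c.
    by have [p []] := lati i; exists p.
  have inj1 : injective (fun i => (h i).1).
    move=> i i' eq_h; have [p [_ p_uniq]] := latj (h i).1.
    have pi := p_uniq (i, (h i).2) (Lh i).
    have /= := p_uniq (i', (h i').2); rewrite eq_h => /(_ (Lh i')).
    by rewrite pi => -[].
  have inj2 : injective (fun i => (h i).2).
    move=> i i' eq_h; have [p [_ p_uniq]] := latk (h i).2.
    have pi := p_uniq (i, (h i).1) (Lh i).
    have /= := p_uniq (i', (h i').1); rewrite eq_h => /(_ (Lh i')).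
    by rewrite pi => -[].
  by exists (perm inj1, perm inj2) => i; rewrite !permE.
have [f Lf] := fin_all_exists perms.
by exists (finfun f); apply/labelsP => c i; rewrite /cell ffunE.
Qed.

Lemma latin_labels_inj f1 f2 L :
  latin_cube L -> labels f1 L -> labels f2 L -> f1 = f2.
Proof.
move=> /latin_cubeP lat /labelsP lab1 /labelsP lab2; apply/ffunP => c.
have eq_f i : (f1 c).1 i = (f2 c).1 i /\ (f1 c).2 i = (f2 c).2 i.
  have [/(_ i)[p [_ p_uniq]] _ _] := lat c.
  have p1 := p_uniq (_, _) (lab1 c i); have p2 := p_uniq (_, _) (lab2 c i).
  by move: p1; rewrite p2 /= => -[-> ->].
by rewrite [LHS]surjective_pairing [RHS]surjective_pairing; congr (_, _);
  apply/permP => i; have [] := eq_f i.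
Qed.

(** Disjointness of the diagonals makes the symbol of a cell well defined. *)
Lemma covering_labels f : covering f -> exists L, labels f L.
Proof.
move=> cov; have cell_inj := covering_inj cov.
have /fin_all_exists[h hK] p : exists ci, p = cell f ci.
  exact/codomP/(forallP cov).
exists [ffun p => (h p).1]; apply/labelsP => c i.
by rewrite ffunE -(cell_inj _ _ (hK (cell f (c, i)))).
Qed.

Lemma covering_labels_inj f L1 L2 :
  covering f -> labels f L1 -> labels f L2 -> L1 = L2.
Proof.
move=> /forallP cov /labelsP lab1 /labelsP lab2; apply/ffunP => p.
by have /codomP[[c i] ->] := cov p; rewrite lab1 lab2.
Qed.

Lemma card_labelling_families L :
  latin_cube L -> (\sum_f labels f L = 1)%N.
Proof.
move=> lat; have [f lab] := latin_labelled lat.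
rewrite (bigD1 f) //= lab big1 // => g /eqP neq_gf.
by case lab_g: (labels g L) => //; case: neq_gf; apply: latin_labels_inj lab.
Qed.

Lemma card_latin_labelled f :
  (\sum_(L : filling | latin_cube L) labels f L = covering f)%N.
Proof.
case: (boolP (covering f)) => [cov | ncov].
  have [L lab] := covering_labels cov.
  rewrite (bigD1 L) ?(labels_covering_latin cov) //= lab big1 //.
  move=> L' /andP[_ /eqP neq_L].
  case lab': (labels f L') => //.
  by case: neq_L; apply: covering_labels_inj lab.
rewrite big1 // => L lat; case lab: (labels f L) => //.
by case/negP: ncov; apply: labels_latin_covering lab.
Qed.

Lemma num_latin_cubes_covering : num_latin_cubes n = (\sum_f covering f)%N.
Proof.
rewrite /num_latin_cubes cardsE -sum1_card.
under eq_bigr => L lat do rewrite -(card_labelling_families lat).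
by rewrite exchange_big /=; apply: eq_bigr => f _; apply: card_latin_labelled.
Qed.

End Families.

Theorem theorem5p5 (n : nat) (hn : (1 <= n)%N) :
  (num_latin_cubes n)%:Z =
  \sum_(A : {ffun 'I_n * 'I_n * 'I_n -> bool})
    (-1) ^+ sigma0 A * Per (int_array A) ^+ (n ^ 2)%N.
Proof. by rewrite signed_sum_Per num_latin_cubes_covering. Qed.
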